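(* Let $A,B>0$ and $l\in\mathbb{N}$. There exists a constant $C>0$ depending only on $A$, $B$ and $l$ such that the following holds. Let $N\in\mathbb{N}$ with $N\ge 200\sqrt{B/A}$, let $d=N^2$, and let $b\in\ell_2^{d,l}$ generate an $A,B$-Gabor Riesz basis for $\ell_2^{d,l}$. Then, for any $1\le k\le l$ and all integers $Q,R$ with $1\le Q,R\le (N/16)\sqrt{A/B}$, $$\frac{1}{N^l}\sum_{\mathbf{j}\in I_d^l:\ |j_k|\ge \frac{NR}{2}}|b(\mathbf{j})|^2+\frac{1}{N^l}\sum_{\mathbf{j}\in I_d^l:\ |j_k|\ge\frac{NQ}{2}}|\mathcal{F}_{d,l}b(\mathbf{j})|^2\ \ge\ \frac{C}{QR}.$$
   Context: Here $d=N^2$, $\mathbb{Z}_d=\mathbb{Z}/d\mathbb{Z}$, and $I_d=[-d/2,d/2)\cap\mathbb{Z}$ is the chosen set of representatives of $\mathbb{Z}_d$ (functions on $\mathbb{Z}_d^l$ are evaluated at points $\mathbf{j}=(j_1,\dots,j_l)\in I_d^l$). $\ell_2^{d,l}$ is the space of complex-valued functions on $\mathbb{Z}_d^l$ with norm $\|b\|_{\ell_2^{d,l}}^2=\frac{1}{N^l}\sum_{\mathbf{j}\in\mathbb{Z}_d^l}|b(\mathbf{j})|^2$. The discrete Fourier transform is $\mathcal{F}_{d,l}(b)(\mathbf{k})=\frac{1}{N^l}\sum_{\mathbf{j}\in\mathbb{Z}_d^l}b(\mathbf{j})e^{-2\pi i\,\mathbf{j}\cdot\mathbf{k}/d}$.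 The discrete Gabor system generated by $b$ is $G_{d,l}(b)=\{\,b(\mathbf{j}-N\mathbf{n})e^{2\pi i\,\mathbf{j}\cdot\mathbf{m}/N}\,\}_{(\mathbf{n},\mathbf{m})\in\{0,\dots,N-1\}^{2l}}$ (functions of $\mathbf{j}\in\mathbb{Z}_d^l$). We say $b$ generates an $A,B$-Gabor Riesz basis for $\ell_2^{d,l}$ if $G_{d,l}(b)=\{h_n\}$ is a basis of $\ell_2^{d,l}$ and $A\sum_n|c_n|^2\le\|\sum_n c_nh_n\|_{\ell_2^{d,l}}^2\le B\sum_n|c_n|^2$ for all scalars $(c_n)$. *)

(* Defs.v *)
From mathcomp Require Import all_boot all_order all_algebra.
From mathcomp Require Import complex.
From mathcomp Require Import reals trigo.

Set Implicit Arguments.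
Unset Strict Implicit.
Unset Printing Implicit Defensive.

Import ComplexField.Normc.
Import Order.TTheory GRing.Theory Num.Theory.
Local Open Scope ring_scope.

(* Z/dZ for d > 0, with the additive group structure of 'I_n.+1.  Unlike 'Z_d
   this is also correct for d = 1; for d = 0 it is the trivial group. *)
Notation Zmod d := 'I_d.-1.+1.

Notation Zvec d l := {ffun 'I_l -> Zmod d}.

(* The representative of u in I_d = [-d/2, d/2). *)
Definition centered (d : nat) (u : Zmod d) : int :=
  if (2 * u < d)%N then u%:Z else u%:Z - d%:Z.

Definition expi (R : realType) (x : R) : R[i] := (cos x +i* sin x)%C.

(* Here d = N^2; the regular module R[i]^o makes this a vectType over R[i]. *)
Notation ell2 R N l := {ffun Zvec (N ^ 2) l -> R[i]^o}.

Section Gabor.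
Variables (R : realType) (N l : nat).

Local Notation ell2 := (ell2 R N l).

Definition ell2_sqnorm (b : ell2) : R :=
  (N%:R ^+ l)^-1 * \sum_j normc (b j) ^+ 2.

Definition dft (b : ell2) : ell2 :=
  [ffun k : Zvec (N ^ 2) l => ((N%:R ^+ l)^-1 * \sum_j (b j : R[i]) *
     expi (- (2 * pi * (\sum_i centered (j i) * centered (k i))%:~R
              / (N ^ 2)%:R)))].

Definition gabor_index : finType :=
  ({ffun 'I_l -> 'I_N} * {ffun 'I_l -> 'I_N})%type.

Definition gabor_atom (b : ell2) (nm : gabor_index) : ell2 :=
  [ffun j : Zvec (N ^ 2) l =>
     (b (j - [ffun i => inZp (N * nm.1 i)]) : R[i]) *
     expi (2 * pi * (\sum_i centered (j i) * (nm.2 i)%:Z)%:~R / N%:R)].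

(* A family with multiplicity: repeated atoms make basis_of fail. *)
Definition gabor_system (b : ell2) : seq ell2 :=
  [seq gabor_atom b nm | nm : gabor_index].

Definition gabor_riesz_basis (A B : R) (b : ell2) : Prop :=
  basis_of fullv (gabor_system b) /\
  forall c : gabor_index -> R[i],
    let s := \sum_nm normc (c nm) ^+ 2 in
    A * s <= ell2_sqnorm (\sum_nm c nm *: gabor_atom b nm) <= B * s.

Definition tail (b : ell2) (k : 'I_l) (t : R) : R :=
  (N%:R ^+ l)^-1 *
  \sum_(j : Zvec (N ^ 2) l | t <= `|(centered (j k))%:~R|) normc (b j) ^+ 2.

End Gabor.

(* Main.v *)
(* The Zak transform Z b turns the Gabor system into a family of characters, so
   the Riesz bounds say exactly that A <= |Z b|^2 <= B everywhere.  In the k-th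
   pair of variables Z b is quasiperiodic, hence has a nonzero winding number and
   must jump on every grid covering the N x N torus.  Smoothing b in frequency at
   scale NQ (convolution with a kernel) makes Z b slowly varying in the first
   variable, truncating b in space at scale NR makes it slowly varying in the
   second.  So on every grid with steps about N/Q and N/R one of the two
   modifications moves Z b by a fixed amount at some grid point.  Averaging over
   all translates of the grid, which has about QR points, and using that Z and
   the discrete Fourier transform are isometries up to scaling bounds the two
   tails from below by a constant over QR. *)
Require Import Defs.
From mathcomp Require Import all_boot all_order all_algebra.
From mathcomp Require Import complex.
From mathcomp Require Import reals trigo.
From mathcomp Require Import topology normedtype derive.
From mathcomp Require Import ring lra zify.

Set Implicit Arguments.
Unset Strict Implicit.
Unset Printing Implicit Defensive.

Import ComplexField.Normc.
Import Order.TTheory GRing.Theory Num.Theory.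
Local Open Scope ring_scope.
Import numFieldNormedType.Exports.

Local Notation Re := complex.Re.
Local Notation Im := complex.Im.

(** * Winding of quasiperiodic functions on a grid *)

Section Angles.
Variable R : realType.
Implicit Types (x y : R) (z w : R[i]).

Lemma normc_ge0 z : 0 <= normc z.
Proof. by case: z => a b; apply: sqrtr_ge0. Qed.

Lemma sqr_normcE z : normc z ^+ 2 = Re z ^+ 2 + Im z ^+ 2.
Proof. by case: z => a b /=; rewrite sqr_sqrtr ?addr_ge0 ?sqr_ge0. Qed.

Lemma normc_eq0 z : (normc z == 0) = (z == 0).
Proof. by apply/eqP/eqP => [/eq0_normc//|->]; rewrite normc0. Qed.

Lemma normc_real x : normc x%:C%C = `|x|.
Proof. by rewrite /= expr0n addr0 sqrtr_sqr. Qed.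

Lemma normc_nat n : normc (n%:R : R[i]) = n%:R.
Proof. by rewrite -(rmorph_nat (real_complex R)) normc_real ger0_norm. Qed.

Lemma normcB z w : normc (z - w) = normc (w - z).
Proof. by rewrite -opprB normcN. Qed.

Lemma ler_normc_sum (I : Type) (r : seq I) (P : pred I) (F : I -> R[i]) :
  normc (\sum_(i <- r | P i) F i) <= \sum_(i <- r | P i) normc (F i).
Proof.
elim/big_ind2: _ => [|x1 x2 y1 y2 h1 h2|//]; first by rewrite normc0.
by apply: le_trans (le_normcD _ _) _; apply: lerD.
Qed.

Lemma expiD x y : expi (x + y) = expi x * expi y.
Proof. by rewrite /expi cosD sinD; simpc; congr (_ +i* _)%C; rewrite addrC. Qed.

Lemma expi0 : expi (0 : R) = 1.
Proof. by rewrite /expi cos0 sin0. Qed.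

Lemma normc_expi x : normc (expi x) = 1.
Proof. by rewrite /= cos2Dsin2 sqrtr1. Qed.

Lemma expi_neq0 x : expi x != 0.
Proof. by rewrite -normc_eq0 normc_expi oner_eq0. Qed.

Lemma expiN x : expi (- x) = (expi x)^-1.
Proof.
by apply: (mulfI (expi_neq0 x)); rewrite -expiD subrr expi0 divff ?expi_neq0.
Qed.

Lemma conjc_expi x : (expi x)^*%C = expi (- x).
Proof. by rewrite /expi cosN sinN. Qed.

Lemma expi_2pi_nat (n : nat) : expi (2 * pi * n%:R : R) = 1.
Proof.
elim: n => [|n IH]; first by rewrite mulr0 expi0.
rewrite -natr1 (_ : 2 * pi * _ = 2 * pi * n%:R + pi *+ 2 :> R); last by rewrite -mulr_natl; ring.
rewrite expiD IH mul1r /expi.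
by rewrite cos2pi sin2pi.
Qed.

Lemma expi_eq1 x : expi x = 1 -> `|x| < 2 * pi -> x = 0.
Proof.
case=> c1 _ xlt; apply/eqP; case: eqVneq => // x0.
have xE : `|x| = (`|x| / 2) *+ 2 by rewrite -mulr_natr; field.
have: cos `|x| = 1 by rewrite cos_norm.
rewrite xE cos_mulr2n cos2sin2 => e.
have s0 : 0 < sin (`|x| / 2).
  apply: sin_gt0_pi; rewrite divr_gt0 ?normr_gt0 //=.
  by rewrite ltr_pdivrMr // mulrC.
have : 0 < sin (`|x| / 2) ^+ 2 by rewrite exprn_gt0.
lra.
Qed.

Lemma ler_sin x : 0 <= x -> sin x <= x.
Proof.
rewrite le_eqVlt => /predU1P[<-|x0]; first by rewrite sin0.
have [|c _] := @MVT _ sin cos _ _ x0.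
  exact/continuous_subspaceT/continuous_sin.
rewrite sin0 !subr0 => ->.
by rewrite ler_piMl ?cos_le1 // ltW.
Qed.

Lemma normc_expi_sub1 x : normc (expi x - 1) <= `|x|.
Proof.
rewrite -(@ler_pXn2r _ 2) ?nnegrE ?normc_ge0 // sqr_normcE /=.
have xE : `|x| = (`|x| / 2) *+ 2 by rewrite -mulr_natr; field.
have -> : (cos x - 1) ^+ 2 + (sin x + - 0) ^+ 2 = 4 * sin (`|x| / 2) ^+ 2.
  have cE : cos x = 1 - 2 * sin (`|x| / 2) ^+ 2.
    by rewrite -[cos x]cos_norm {1}xE cos_mulr2n cos2sin2 -mulr_natl; ring.
  by have := cos2Dsin2 x; rewrite oppr0 addr0; lra.
have h := ler_sin (divr_ge0 (normr_ge0 x) (ler0n _ 2)).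
(* Up to [4] the half-angle is at most [2 <= pi], so its sine is nonnegative and [sin t <= t] can be
   squared. Beyond [4] the bound [|sin| <= 1] is enough. *)
have [xp|xp] := leP `|x| 4.
  have s0 : 0 <= sin (`|x| / 2).
    have := normr_ge0 x; rewrite le_eqVlt => /predU1P[<-|x0].
      by rewrite mul0r sin0.
    have [x4|x4] := ltP (`|x| / 2) pi; first by apply/ltW/sin_gt0_pi; lra.
    have := @pi_ge2 R; move=> p2.
    have -> : `|x| / 2 = pi by lra.
    by rewrite sinpi.
  nra.
have := sin_le1 (`|x| / 2); have := sin_geN1 (`|x| / 2); nra.
Qed.

(** Agrees with the argument of [z] on the open right half-plane only. *)
Definition angle z : R := atan (Im z / Re z).

Lemma angleE z : 0 < Re z -> z = (normc z)%:C%C * expi (angle z).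
Proof.
case: z => a b /= a0; rewrite /angle /expi /=.
have n0 : 0 < a ^+ 2 + b ^+ 2 by rewrite ltr_wpDr ?sqr_ge0 ?exprn_gt0.
have c0 : cos (atan (b / a)) = a / Num.sqrt (a ^+ 2 + b ^+ 2).
  rewrite cos_atan (_ : 1 + _ = (a ^+ 2 + b ^+ 2) / a ^+ 2); last first.
    by field; lra.
  rewrite sqrtrM ?ltW // sqrtrV ?sqr_ge0 // sqrtr_sqr gtr0_norm //.
  by rewrite invfM invrK mulrC.
have s0 : sin (atan (b / a)) = b / Num.sqrt (a ^+ 2 + b ^+ 2).
  have := atanK (b / a); rewrite /tan c0.
  move=> /(congr1 (fun t => t * (a / Num.sqrt (a ^+ 2 + b ^+ 2)))).
  rewrite divfK; last by rewrite mulf_neq0 ?invr_eq0 ?sqrtr_eq0 -?ltNge ?gt_eqF.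
  by move=> ->; rewrite mulrA divfK // gt_eqF.
rewrite c0 s0; simpc.
by rewrite ![_ * (_ / _)]mulrC !divfK // gt_eqF // sqrtr_gt0.
Qed.

Lemma cos_pi3 : cos (pi / 3 : R) = 1 / 2.
Proof.
have p := @pi_gt0 R.
have s0 : 0 < sin (pi / 3 : R) by apply: sin_gt0_pi; lra.
have : sin (pi / 3 *+ 2) = sin (pi / 3 : R).
  have -> : pi / 3 *+ 2 = - (pi / 3) + pi :> R by rewrite -mulr_natr; field.
  by rewrite sinDpi sinN opprK.
rewrite sin_mulr2n => h; apply: (mulIf (lt0r_neq0 s0)).
by rewrite -[in RHS]h -mulr_natl; field.
Qed.

(** The hypothesis says that the cosine of the angle exceeds [1 / 2], the cosine of [pi / 3]. *)
Lemma angle_lt z : normc z < 2 * Re z -> `|angle z| < pi / 3.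
Proof.
move=> h; have r0 : 0 < Re z by have := normc_ge0 z; lra.
have zn : 0 < normc z.
  rewrite lt_neqAle normc_ge0 andbT eq_sym normc_eq0.
  by apply: contraTneq r0 => ->; rewrite ltxx.
have cE : Re z = normc z * cos (angle z).
  by rewrite {1}[z]angleE //=; rewrite mul0r subr0.
have p := @pi_gt0 R.
have := atan_gtNpi2 (Im z / Re z); have := atan_ltpi2 (Im z / Re z).
rewrite -/(angle z) => h1 h2.
have a2 : `|angle z| < pi / 2 by rewrite ltr_norml h1 h2.
rewrite -ltr_cos ?in_itv /= ?normr_ge0 //=; first last.
- by lra.
- by lra.
rewrite cos_pi3 cos_norm.
have : 0 < normc z * (2 * cos (angle z) - 1) by lra.
rewrite pmulr_rgt0 //; lra.
Qed.

(** In the triangle [0], [z], [w] the side from [z] to [w] is strictly the shortest, so the opposite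
    angle, at the origin, is below [pi / 3]. The computation is the law of cosines for
    [t = w / z]. *)
Lemma normc_ratio_lt (a : R) z w : 0 < a -> a <= normc z -> a <= normc w ->
  normc (w - z) < a -> normc (w / z) < 2 * Re (w / z).
Proof.
move=> a0 az aw wz.
have u0 : 0 < normc z by lra.
have z0 : z != 0 by rewrite -normc_eq0 gt_eqF.
set t := w / z; have wE : w = t * z by rewrite /t divfK.
clearbody t.
move: aw wz; rewrite wE -[X in _ - X]mul1r -mulrBl !normcM.
have tn := normc_ge0 t; have vn := normc_ge0 (t - 1).
have tE := sqr_normcE t; have vE := sqr_normcE (t - 1).
have reE : Re (t - 1) = Re t - 1 by case: (t).
have imE : Im (t - 1) = Im t by case: (t) => ? ? /=; rewrite subr0.
rewrite reE imE in vE.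
move: (normc t) (normc (t - 1)) (normc z) tn vn tE vE u0 az => p v u.
move=> p0 v0 tE vE u0 au apu vua.
have v2 : (v * u) ^+ 2 < a ^+ 2 by rewrite ltr_pXn2r ?nnegrE ?mulr_ge0 // ltW.
have v2E : v ^+ 2 = p ^+ 2 + 1 - 2 * Re t by rewrite vE tE; ring.
have key : a ^+ 2 <= (p * u) ^+ 2 + u ^+ 2 - p * u * u.
  have m (s t' : R) : a <= s -> s <= t' -> a ^+ 2 <= t' ^+ 2 + s ^+ 2 - t' * s.
    move=> as_ st; have : 0 <= t' * (t' - s) by apply: mulr_ge0; lra.
    have : a ^+ 2 <= s ^+ 2 by rewrite ler_pXn2r ?nnegrE //; lra.
    by rewrite !expr2; lra.
  have [pu|/ltW pu] := leP u (p * u); first exact: m.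
  by have := m _ _ apu pu; lra.
have : 0 < u ^+ 2 * (2 * Re t - p).
  by move: v2; rewrite exprMn v2E; lra.
by rewrite pmulr_rgt0 ?exprn_gt0 // subr_gt0.
Qed.

(** The cone of directions making an angle less than [pi / 3] with [z]. *)
Definition near_dir z w : Prop := normc (w / z) < 2 * Re (w / z).

(* [x] and [y] are positions on the unit torus; the vertical edges are compared
   up to the phase of the connection with curvature [2 pi], so the angles around
   each cell sum exactly to [- 2 pi] times its area. *)
Lemma no_quasiperiodic_section (K L : nat) (x y : nat -> R)
    (G : nat -> nat -> R[i]) :
  (forall i j, G i j != 0) ->
  (forall i j, (i < K)%N -> (j <= L)%N -> near_dir (G i j) (G i.+1 j)) ->
  (forall i j, (i <= K)%N -> (j < L)%N ->
    near_dir (expi (2 * pi * ((y j.+1 - y j) * x i)) * G i j) (G i j.+1)) ->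
  (forall i j, (i < K)%N -> (j < L)%N ->
    0 <= (x i.+1 - x i) * (y j.+1 - y j) < 1 / 3) ->
  (forall i, G i L = G i 0%N) ->
  (forall j, G K j = expi (2 * pi * y j) * G 0%N j) ->
  x K = x 0%N + 1 -> y L = y 0%N + 1 -> False.
Proof.
move=> G0 hor ver area GL GK xK yL.
pose tw i j := expi (2 * pi * ((y j.+1 - y j) * x i)).
pose al i j := angle (G i.+1 j / G i j).
pose be i j := angle (G i j.+1 / (tw i j * G i j)).
pose f i j := (x i.+1 - x i) * (y j.+1 - y j).
have near_gt0 z w : near_dir z w -> 0 < Re (w / z).
  by rewrite /near_dir; have := normc_ge0 (w / z); lra.
have p0 := @pi_gt0 R.
have twE i j : tw i.+1 j = tw i j * expi (2 * pi * f i j).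
  by rewrite /tw /f -expiD; congr expi; ring.
have tw0 i j : tw i j != 0 := expi_neq0 _.
(* The ratios around a cell multiply to the inverse of its curvature phase, so the exponential of
   this sum is [1]. Four angles below [pi / 3] and a curvature below [2 * pi / 3] keep the sum
   inside [(- 2 pi, 2 pi)], hence it is zero. *)
have cell i j : (i < K)%N -> (j < L)%N ->
    al i j + be i.+1 j - al i j.+1 - be i j + 2 * pi * f i j = 0.
  move=> iK jL.
  have h1 := hor i j iK (ltnW jL); have h2 := hor i j.+1 iK jL.
  have h3 := ver i j (ltnW iK) jL; have h4 := ver i.+1 j iK jL.
  have /andP[f0 f1] := area i j iK jL; rewrite -/(f i j) in f0 f1.
  have a1 := angle_lt h1; have a2 := angle_lt h2.
  have a3 := angle_lt h3; have a4 := angle_lt h4.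
  apply: expi_eq1; last first.
    rewrite -/(al i j) in a1; rewrite -/(al i j.+1) in a2.
    rewrite -/(be i j) in a3; rewrite -/(be i.+1 j) in a4.
    move: a1 a2 a3 a4; rewrite !ltr_norml => /andP[? ?] /andP[? ?] /andP[? ?] /andP[? ?].
    by apply/andP; split; nra.
  have e1 := angleE (near_gt0 _ _ h1); have e2 := angleE (near_gt0 _ _ h2).
  have e3 := angleE (near_gt0 _ _ h3); have e4 := angleE (near_gt0 _ _ h4).
  rewrite -/(al i j) in e1; rewrite -/(al i j.+1) in e2.
  rewrite -/(be i j) in e3; rewrite -/(be i.+1 j) in e4.
  set X := expi _.
  have X1 : normc X = 1 by apply: normc_expi.
  have prod1 : (G i.+1 j / G i j) * (G i.+1 j.+1 / (tw i.+1 j * G i.+1 j)) /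
     (G i.+1 j.+1 / G i j.+1) / (G i j.+1 / (tw i j * G i j)) * expi (2 * pi * f i j) = 1.
    rewrite twE; field.
    by rewrite !G0 !tw0 expi_neq0.
  rewrite e1 e2 e3 e4 in prod1.
  set n1 := normc (G i.+1 j / G i j) in prod1.
  set n2 := normc (G i.+1 j.+1 / G i j.+1) in prod1.
  set n3 := normc (G i j.+1 / (_ * G i j)) in prod1.
  set n4 := normc (G i.+1 j.+1 / (_ * G i.+1 j)) in prod1.
  have XE : X = expi (al i j) * expi (be i.+1 j) / expi (al i j.+1) /
      expi (be i j) * expi (2 * pi * f i j).
    by rewrite /X !expiD !expiN.
  have prod2 : (n1 * n4 / n2 / n3)%:C%C * X = 1.
    by rewrite -prod1 XE !rmorphM !fmorphV !invfM; ring.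
  have n1p : 0 <= n1 * n4 / n2 / n3 by rewrite !(mulr_ge0, invr_ge0) ?normc_ge0.
  have : normc ((n1 * n4 / n2 / n3)%:C%C * X) = 1 by rewrite prod2 normc1.
  rewrite normcM X1 mulr1 normc_real ger0_norm // => n1E.
  by move: prod2; rewrite n1E mul1r.
have total : \sum_(i < K) \sum_(j < L)
    (al i j + be i.+1 j - al i j.+1 - be i j + 2 * pi * f i j) = 0.
  by apply: big1 => i _; apply: big1 => j _; apply: cell.
(* Opposite sides of the torus carry equal angles. On the vertical sides, the quasiperiodicity
   factor of [G] cancels against the change of [tw] when [x] grows by one. *)
have alL i : al i L = al i 0%N by rewrite /al !GL.
have beK j : be K j = be 0%N j.
  rewrite /be; congr angle.
  have -> : tw K j = tw 0%N j * expi (2 * pi * (y j.+1 - y j)).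
    by rewrite /tw xK -expiD; congr expi; ring.
  have -> : G K j.+1 = expi (2 * pi * (y j.+1 - y j)) * expi (2 * pi * y j) * G 0%N j.+1.
    by rewrite GK -expiD; congr (expi _ * _); ring.
  rewrite GK; field.
  by rewrite !G0 !tw0 !expi_neq0.
have tele (u : nat -> R) n : \sum_(i < n) (u i.+1 - u i) = u n - u 0%N.
  by rewrite -(telescope_sumr _ (leq0n n)) big_mkord.
have s1 : \sum_(i < K) \sum_(j < L) (al i j - al i j.+1) = 0.
  apply: big1 => i _.
  have := tele (fun j => - al i j) L; rewrite alL subrr => {2}<-.
  by apply: eq_bigr => j _; rewrite opprK addrC.
have s2 : \sum_(i < K) \sum_(j < L) (be i.+1 j - be i j) = 0.
  by rewrite exchange_big; apply: big1 => j _; rewrite (tele (be^~ j)) beK subrr.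
(* The signed areas of the cells add up to one, so the curvature survives while all edge angles
   cancel. *)
have s3 : \sum_(i < K) \sum_(j < L) (2 * pi * f i j) = 2 * pi.
  under eq_bigr do rewrite -mulr_sumr -mulr_sumr tele yL addrAC subrr add0r mulr1.
  by rewrite -mulr_sumr tele xK addrAC subrr add0r mulr1.
have : \sum_(i < K) \sum_(j < L)
      (al i j + be i.+1 j - al i j.+1 - be i j + 2 * pi * f i j) =
    \sum_(i < K) \sum_(j < L) (al i j - al i j.+1) +
    \sum_(i < K) \sum_(j < L) (be i.+1 j - be i j) +
    \sum_(i < K) \sum_(j < L) (2 * pi * f i j).
  rewrite -!big_split /=; apply: eq_bigr => i _.
  by rewrite -!big_split; apply: eq_bigr => j _ /=; ring.
rewrite total s1 s2 s3; lra.
Qed.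

End Angles.

(** * Characters of finite cyclic groups *)

Section CyclicNorm.
Variable n : nat.
Implicit Types u v : 'I_n.+1.

Definition cyc_norm u : nat := minn u (n.+1 - u).

Lemma cyc_normN u : cyc_norm (- u) = cyc_norm u.
Proof.
rewrite /cyc_norm /=; have ult := ltn_ord u.
have [->|u0] := eqVneq (val u) 0%N; first by rewrite subn0 modnn min0n.
rewrite modn_small; last by move: u0 => /=; lia.
by rewrite minnC; congr minn; lia.
Qed.

Lemma cyc_normD u v : (cyc_norm (u + v)%R <= cyc_norm u + cyc_norm v)%N.
Proof.
rewrite /cyc_norm /=; have ult := ltn_ord u; have vlt := ltn_ord v.
have [uv|uv] := ltnP (u + v)%N n.+1; first by rewrite modn_small //; lia.
have -> : ((u + v) %% n.+1 = u + v - n.+1)%N.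
  by rewrite -{1}(subnK uv) modnDr modn_small //; lia.
lia.
Qed.

Lemma cyc_norm_inZp (a : nat) : (cyc_norm (inZp a) <= a)%N.
Proof. by rewrite /cyc_norm geq_min leq_mod. Qed.

End CyclicNorm.

(** Translates the cut-off in [tail] into the cyclic norm; at [u = d / 2] the representative is
    [- d / 2] and both sides still agree. *)
Lemma abs_centered (d : nat) (u : Zmod d) : (0 < d)%N ->
  `|centered u|%N = cyc_norm u.
Proof.
case: d u => // d u _; rewrite /centered /cyc_norm /=.
have ult : (u < d.+1)%N := ltn_ord u.
case: ifP => h; last by rewrite distnEr ?(ltnW ult) //; lia.
by rewrite absz_nat; lia.
Qed.

Section Characters.
Variable R : realType.

Definition unit_root (n a : nat) : R[i] := expi (2 * pi * a%:R / n%:R).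

Lemma unit_rootD n a b : unit_root n (a + b)%N = unit_root n a * unit_root n b.
Proof. by rewrite /unit_root -expiD natrD; congr expi; ring. Qed.

Lemma unit_rootM n a : unit_root n (n * a)%N = 1.
Proof.
have [->|n0] := eqVneq n 0%N; first by rewrite /unit_root mul0n mulr0 mul0r expi0.
rewrite /unit_root -(expi_2pi_nat R a); congr expi; rewrite natrM; field.
by rewrite pnatr_eq0.
Qed.

Lemma unit_root_mod n a : unit_root n (a %% n)%N = unit_root n a.
Proof.
by rewrite [in RHS](divn_eq a n) unit_rootD mulnC unit_rootM mul1r.
Qed.

Lemma eq_unit_root n a b : a = b %[mod n] -> unit_root n a = unit_root n b.
Proof. by move=> ab; rewrite -unit_root_mod ab unit_root_mod. Qed.

Lemma unit_rootMl m n a : (0 < m)%N -> unit_root (m * n)%N (m * a)%N = unit_root n a.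
Proof.
move=> m0; rewrite /unit_root !natrM; congr expi.
have [->|n0] := eqVneq n 0%N; first by rewrite mulr0 invr0 !mulr0.
by field; rewrite !pnatr_eq0 n0 -lt0n m0.
Qed.

Lemma normc_unit_root n a : normc (unit_root n a) = 1.
Proof. exact: normc_expi. Qed.

Definition omega n (u v : 'I_n.+1) : R[i] := unit_root n.+1 (u * v)%N.

Section Omega.
Variable n : nat.
Implicit Types u v w : 'I_n.+1.

Lemma omegaC u v : omega u v = omega v u.
Proof. by rewrite /omega mulnC. Qed.

Lemma omegaDl u v w : omega (u + v) w = omega u w * omega v w.
Proof.
by rewrite /omega -unit_rootD -mulnDl; apply: eq_unit_root; rewrite /= modnMml.
Qed.

Lemma omegaDr u v w : omega w (u + v) = omega w u * omega w v.
Proof. by rewrite omegaC omegaDl !(omegaC w). Qed.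

Lemma omega0l u : omega 0 u = 1.
Proof. by rewrite /omega mul0n /unit_root mulr0 mul0r expi0. Qed.

Lemma normc_omega u v : normc (omega u v) = 1.
Proof. exact: normc_unit_root. Qed.

Lemma omega_neq0 u v : omega u v != 0.
Proof. exact: expi_neq0. Qed.

Lemma omegaNl u v : omega (- u) v = (omega u v)^-1.
Proof.
by apply: (mulfI (omega_neq0 u v)); rewrite -omegaDl subrr omega0l divff ?omega_neq0.
Qed.

Lemma omegaNr u v : omega u (- v) = (omega u v)^-1.
Proof. by rewrite omegaC omegaNl omegaC. Qed.

Lemma conjc_omega u v : (omega u v)^*%C = omega (- u) v.
Proof. by rewrite omegaNl {1}/omega /unit_root conjc_expi expiN. Qed.

Lemma sum_omega u : \sum_v omega u v = (if u == 0 then n.+1%:R else 0).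
Proof.
case: eqVneq => [->|u0].
  by under eq_bigr do rewrite omega0l; rewrite sumr_const card_ord.
have n0 : (0 < n)%N by case: (n) u u0 => // v; rewrite ord1 eqxx.
(* Translating [v] by one multiplies the sum by [omega u 1], which differs from [1] because its
   phase lies strictly between [0] and [2 pi]. *)
set s := \sum_v _; have sE : s = omega u (inZp 1) * s.
  rewrite {1}/s (reindex_inj (addrI (inZp 1 : 'I_n.+1))) mulr_sumr.
  by apply: eq_bigr => v _; rewrite omegaDr.
apply/eqP; have : (1 - omega u (inZp 1)) * s == 0.
  by rewrite mulrBl mul1r -sE subrr.
rewrite mulf_eq0 => /orP[|//]; rewrite subr_eq0 => /eqP e.
have p := @pi_gt0 R.
have u_gt0 : (0 < u)%N by rewrite lt0n; apply: contra u0 => /eqP h; apply/eqP/val_inj.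
have lt2pi : 2 * pi * u%:R / n.+1%:R < 2 * pi :> R.
  by rewrite ltr_pdivrMr ?ltr0n // ltr_pM2l ?ltr_nat //; lra.
have gt0 : 0 < 2 * pi * u%:R / n.+1%:R :> R.
  by rewrite divr_gt0 ?ltr0n // mulr_gt0 ?ltr0n //; lra.
have : 2 * pi * u%:R / n.+1%:R = 0 :> R.
  apply: expi_eq1; last by rewrite gtr0_norm.
  by rewrite e /omega /= modn_small ?ltnS // muln1.
by move=> h; move: gt0; rewrite h ltxx.
Qed.

(** The chord is bounded by the arc for whichever of [u] and [- u] has the smaller representative;
    inverting a unimodular number keeps its distance to [1]. *)
Lemma normc_omega_sub1 u v :
  normc (omega u v - 1) <= 2 * pi * (cyc_norm u)%:R * v%:R / n.+1%:R.
Proof.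
have p := @pi_ge0 R.
have bound w : normc (omega w v - 1) <= 2 * pi * w%:R * v%:R / n.+1%:R.
  rewrite /omega /unit_root; apply: le_trans (normc_expi_sub1 _) _.
  rewrite ger0_norm ?natrM ?mulrA //.
  by rewrite !(mulr_ge0, invr_ge0) ?ler0n.
rewrite /cyc_norm; have [h|h] := leqP u (n.+1 - u).
  exact: bound.
have -> : normc (omega u v - 1) = normc (omega (- u) v - 1).
  rewrite omegaNl -[LHS]mul1r -(normc_omega (- u) v) -normcM omegaNl.
  by rewrite mulrBr mulVf ?omega_neq0 // mulr1 normcB.
suff -> : (n.+1 - u)%N = (- u : 'I_n.+1) by apply: bound.
by rewrite /= modn_small //; lia.
Qed.

End Omega.

Lemma normc_sqrC (z : R[i]) : (normc z ^+ 2)%:C%C = z * z^*%C.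
Proof. by rewrite -sqr_normc rmorphXn. Qed.

Lemma parseval_orthogonal (I J : finType) (M : I -> J -> R[i]) (c : R) :
  (forall i i', \sum_j M i j * (M i' j)^*%C = (if i == i' then c else 0)%:C%C) ->
  forall f : I -> R[i],
  \sum_j normc (\sum_i f i * M i j) ^+ 2 = c * \sum_i normc (f i) ^+ 2.
Proof.
move=> orth f; apply: complexI.
rewrite rmorphM !rmorph_sum /=.
transitivity (\sum_j \sum_i \sum_i' f i * (f i')^*%C * (M i j * (M i' j)^*%C)).
  apply: eq_bigr => j _; rewrite normc_sqrC rmorph_sum mulr_suml.
  apply: eq_bigr => i _; rewrite mulr_sumr; apply: eq_bigr => i' _.
  by rewrite rmorphM /=; ring.
rewrite exchange_big mulr_sumr; apply: eq_bigr => i _.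
rewrite exchange_big (bigD1 i) //= -mulr_sumr orth eqxx big1 ?addr0.
  by rewrite -normc_sqrC mulrC.
by move=> i' ii'; rewrite -mulr_sumr orth eq_sym (negPf ii') mulr0.
Qed.

Section Chi.
Variables n l : nat.
Implicit Types u v w : {ffun 'I_l -> 'I_n.+1}.

Definition chi u v : R[i] := \prod_i omega (u i) (v i).

Lemma chiC u v : chi u v = chi v u.
Proof. by apply: eq_bigr => i _; rewrite omegaC. Qed.

Lemma chiDl u v w : chi (u + v) w = chi u w * chi v w.
Proof. by rewrite /chi -big_split; apply: eq_bigr => i _; rewrite !ffunE omegaDl. Qed.

Lemma chiDr u v w : chi w (u + v) = chi w u * chi w v.
Proof. by rewrite chiC chiDl !(chiC w). Qed.

Lemma chi0l u : chi 0 u = 1.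
Proof. by rewrite /chi big1 // => i _; rewrite !ffunE omega0l. Qed.

Lemma normc_chi u v : normc (chi u v) = 1.
Proof.
rewrite /chi; elim/big_ind: _ => [|x y hx hy|i _]; first exact: normc1.
  by rewrite normcM hx hy mulr1.
exact: normc_omega.
Qed.

Lemma chi_neq0 u v : chi u v != 0.
Proof. by rewrite -normc_eq0 normc_chi oner_eq0. Qed.

Lemma chiNl u v : chi (- u) v = (chi u v)^-1.
Proof.
by apply: (mulfI (chi_neq0 u v)); rewrite -chiDl subrr chi0l divff ?chi_neq0.
Qed.

Lemma conjc_chi u v : (chi u v)^*%C = chi (- u) v.
Proof.
by rewrite /chi rmorph_prod; apply: eq_bigr => i _; rewrite ffunE -conjc_omega.
Qed.

Lemma sum_chi u : \sum_v chi u v = (if u == 0 then n.+1%:R ^+ l else 0).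
Proof.
transitivity (\prod_i \sum_(v : 'I_n.+1) omega (u i) v).
  by rewrite bigA_distr_bigA.
under eq_bigr do rewrite sum_omega.
case: eqVneq => [->|/eqP u0].
  by under eq_bigr do rewrite ffunE eqxx; rewrite prodr_const card_ord.
apply/eqP; rewrite prodf_seq_eq0; apply/hasP.
have /existsP[i ui] : [exists i, u i != 0].
  rewrite -negb_forall; apply/negP => /forallP h; apply: u0.
  by apply/ffunP => i; rewrite ffunE; apply/eqP.
by exists i; rewrite ?mem_index_enum //= (negPf ui).
Qed.

Lemma parseval_chi (f : {ffun 'I_l -> 'I_n.+1} -> R[i]) :
  \sum_v normc (\sum_u f u * chi u v) ^+ 2 =
  n.+1%:R ^+ l * \sum_u normc (f u) ^+ 2.
Proof.
apply: parseval_orthogonal => u u'.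
under eq_bigr do rewrite conjc_chi -chiDl.
rewrite sum_chi subr_eq0; case: eqP => _; last by rewrite rmorph0.
by rewrite rmorphXn rmorph_nat.
Qed.

End Chi.

Lemma parseval_omega n (f : 'I_n.+1 -> R[i]) :
  \sum_v normc (\sum_u f u * omega u v) ^+ 2 =
  n.+1%:R * \sum_u normc (f u) ^+ 2.
Proof.
apply: parseval_orthogonal => u u'.
under eq_bigr do rewrite conjc_omega -omegaDl.
rewrite sum_omega subr_eq0; case: eqP => _; last by rewrite rmorph0.
by rewrite rmorph_nat.
Qed.

End Characters.

(** * A smoothing kernel on a cyclic group *)

(** Sum [0 <= (q * f j - p * g j) ^+ 2] and divide by [2 * p * q]; if [p] or [q] is zero, the
    corresponding family vanishes. *)
Lemma cauchy_schwarz_bound (R : realType) (J : finType) (f g : J -> R) (p q : R) :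
  0 <= p -> 0 <= q -> \sum_j f j ^+ 2 <= p ^+ 2 -> \sum_j g j ^+ 2 <= q ^+ 2 ->
  \sum_j f j * g j <= p * q.
Proof.
have zero (u : J -> R) : \sum_j u j ^+ 2 <= 0 ^+ 2 -> forall j, u j = 0.
  rewrite expr0n /= => le0 j; apply/eqP; rewrite -sqrf_eq0.
  have : \sum_j u j ^+ 2 == 0 by rewrite eq_le le0 sumr_ge0 // => *; apply: sqr_ge0.
  by rewrite psumr_eq0 => [/allP|*]; [apply; apply: mem_index_enum|apply: sqr_ge0].
rewrite le_eqVlt => /predU1P[<- q0 /zero f0 _|p0].
  by rewrite mul0r big1 // => j _; rewrite f0 mul0r.
rewrite le_eqVlt => /predU1P[<- _ /zero g0|q0 fp gq].
  by rewrite mulr0 big1 // => j _; rewrite g0 mulr0.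
rewrite -(ler_pM2l (_ : 0 < 2 * (p * q))); last by rewrite !mulr_gt0.
apply: (@le_trans _ _ (\sum_j (q ^+ 2 * f j ^+ 2 + p ^+ 2 * g j ^+ 2))).
  rewrite mulr_sumr; apply: ler_sum => j _.
  by have := sqr_ge0 (q * f j - p * g j); rewrite sqrrB !exprMn; lra.
rewrite big_split -!mulr_sumr /=.
have h1 : q ^+ 2 * \sum_j f j ^+ 2 <= q ^+ 2 * p ^+ 2 by rewrite ler_pM2l ?exprn_gt0.
have h2 : p ^+ 2 * \sum_j g j ^+ 2 <= p ^+ 2 * q ^+ 2 by rewrite ler_pM2l ?exprn_gt0.
by apply: le_trans (lerD h1 h2) _; rewrite le_eqVlt; apply/predU1P; left; ring.
Qed.

Section Kernel.
Variables (R : realType) (n T : nat).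
Implicit Types u v w x a : 'I_n.+1.

Definition dirichlet (S : {set 'I_n.+1}) w : R[i] := \sum_(u in S) omega R w u.

Lemma dirichlet_shift S w a :
  dirichlet S (w + a) - dirichlet S w =
  \sum_u ((u \in S)%:R * (omega R u a - 1)) * omega R u w.
Proof.
rewrite /dirichlet -sumrB big_mkcond; apply: eq_bigr => u _.
case: (u \in S); rewrite ?mul0r // mul1r omegaC omegaDr (omegaC _ w u).
by rewrite mulrBl mul1r mulrC.
Qed.

Lemma dirichlet_sqnorm S :
  \sum_w normc (dirichlet S w) ^+ 2 = n.+1%:R * #|S|%:R.
Proof.
have -> : \sum_w normc (dirichlet S w) ^+ 2 =
    \sum_w normc (\sum_u (u \in S)%:R * omega R u w) ^+ 2.
  apply: eq_bigr => w _; congr (normc _ ^+ 2); rewrite /dirichlet big_mkcond.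
  by apply: eq_bigr => u _; rewrite omegaC; case: (u \in S); rewrite ?mul1r ?mul0r.
rewrite parseval_omega -sum1_card natr_sum big_mkcond /=; congr (_ * _).
rewrite [RHS]big_mkcond; apply: eq_bigr => u _; case: (u \in S).
  by rewrite normc1 expr1n.
by rewrite normc0 expr0n.
Qed.

(** A shift by [a] multiplies the coefficient at [u] by [omega u a], which is close to [1] for [u]
    near zero; Parseval then sums the squares over [S]. *)
Lemma dirichlet_shift_sqnorm (S : {set _}) a (r : nat) :
  {in S, forall u, (cyc_norm u <= r)%N} ->
  \sum_w normc (dirichlet S (w + a) - dirichlet S w) ^+ 2 <=
  n.+1%:R * #|S|%:R * (2 * pi * r%:R * a%:R / n.+1%:R) ^+ 2.
Proof.
move=> Sr; under eq_bigr do rewrite dirichlet_shift.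
rewrite parseval_omega -mulrA ler_pM2l ?ltr0n //.
rewrite -sum1_card natr_sum mulr_suml [leRHS]big_mkcond /=.
apply: ler_sum => u _; case: ifP => uS; last by rewrite mul0r normc0 expr0n.
rewrite !mul1r ler_pXn2r ?nnegrE ?normc_ge0 //; last first.
  by rewrite !(mulr_ge0, invr_ge0) ?pi_ge0.
apply: le_trans (normc_omega_sub1 _ _ _) _.
by rewrite !ler_wpM2r ?invr_ge0 // ler_wpM2l ?mulr_ge0 ?pi_ge0 // ler_nat Sr.
Qed.

Definition ball (r : nat) : {set 'I_n.+1} := [set u | (cyc_norm u <= r)%N].

Lemma cyc_norm_sub_inZp u (b : nat) : (cyc_norm (u - inZp b)%R <= `|u - b|)%N.
Proof.
have [bu|/ltnW ub] := leqP b u.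
  have -> : u - inZp b = inZp (u - b).
    apply/eqP; rewrite subr_eq; apply/eqP/val_inj => /=.
    by rewrite modnDm subnK // modn_small.
  by rewrite distnEl // cyc_norm_inZp.
rewrite -cyc_normN opprB distnEr //.
have -> : inZp b - u = inZp (b - u).
  apply/eqP; rewrite subr_eq; apply/eqP/val_inj => /=.
  by rewrite modnDml subnK.
exact: cyc_norm_inZp.
Qed.

(** Width parameter of the trapezoid: flat on radius [T], with slopes of length [2 * h], about [T].
    A smaller [h] would spoil the ratio of the two ball sizes, and with it the variation of the
    kernel. *)
Let h := T./2.

Let half_bound : (h + T + h <= 2 * T)%N.
Proof. by rewrite /h; lia. Qed.

Lemma card_ball : (#|ball (h + T)| <= 3 * #|ball h|)%N.
Proof.
(* The small ball and its translates by [c] and [- c] cover the large one: a distance from [h + 1]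
   to [h + T <= 3 * h + 1] falls within [h] of [2 * h + 1]. *)
pose c : 'I_n.+1 := inZp (2 * h + 1).
have hT : (T <= 2 * h + 1)%N by rewrite /h; lia.
have half u : (h < cyc_norm u)%N -> (cyc_norm u <= h + T)%N ->
    (u <= n.+1 - u)%N -> u - c \in ball h.
  move=> h1 h2 h3; move: h1 h2; rewrite inE {1 2}/cyc_norm (minn_idPl h3) => h1 h2.
  by apply: leq_trans (cyc_norm_sub_inZp _ _) _; lia.
have sub : ball (h + T) \subset
    ball h :|: (+%R c) @: ball h :|: (+%R (- c)) @: ball h.
  apply/fintype.subsetP => u; rewrite [u \in ball _]inE => uT; rewrite !inE.
  have [//|hu] := leqP (cyc_norm u) h.
  have [uu|uu] := leqP u (n.+1 - u).
    apply/orP; left; apply/imsetP; exists (u - c); first exact: half.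
    by rewrite addrC subrK.
  apply/orP; right; apply/imsetP; exists (u + c); last by rewrite addrC addrK.
  rewrite inE -cyc_normN opprD.
  suff : - u - c \in ball h by rewrite inE.
  apply: half; rewrite ?cyc_normN //= modn_small; have := ltn_ord u; lia.
apply: leq_trans (subset_leq_card sub) _.
apply: leq_trans (leq_card_setU _ _) _.
apply: leq_trans (leq_add (leq_card_setU _ _) (leqnn _)) _.
by rewrite !card_imset; [rewrite !mulSn mul0n addn0 addnA|apply: addrI|apply: addrI].
Qed.

Lemma ball_gt0 : (0 < #|ball h|)%N.
Proof. by apply/card_gt0P; exists 0; rewrite inE /cyc_norm min0n. Qed.

(* A de la Vallee-Poussin kernel: its transform [vp_mult] is the trapezoid
   obtained by convolving the indicators of two balls. *)
Definition vp_kernel w : R[i] :=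
  (n.+1%:R * #|ball h|%:R)^-1 * (dirichlet (ball (h + T)) w * dirichlet (ball h) w).

Definition vp_mult x : R :=
  #|[set u in ball h | - x - u \in ball (h + T)]|%:R / #|ball h|%:R.

Lemma vp_mult_ge0 x : 0 <= vp_mult x.
Proof. by rewrite divr_ge0. Qed.

Lemma vp_mult_le1 x : vp_mult x <= 1.
Proof.
rewrite ler_pdivrMr ?ltr0n ?ball_gt0 // mul1r ler_nat subset_leq_card //.
by apply/fintype.subsetP => u; rewrite inE => /andP[].
Qed.

Lemma vp_mult_eq1 x : (cyc_norm x <= T)%N -> vp_mult x = 1.
Proof.
move=> xT; rewrite /vp_mult (_ : finset _ = ball h).
  by rewrite divff // pnatr_eq0 -lt0n ball_gt0.
apply/setP => u; rewrite !inE; case: leqP => //= uh.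
apply: leq_trans (cyc_normD _ _) _; rewrite !cyc_normN; lia.
Qed.

(** After expanding both Dirichlet sums, orthogonality of characters keeps only the pairs with
    [v = - x - u], which leaves a convolution of indicators. *)
Lemma vp_kernel_transform x :
  \sum_w vp_kernel w * omega R w x = (vp_mult x)%:C%C.
Proof.
have D0 : n.+1%:R != 0 :> R[i] by rewrite pnatr_eq0.
have M0 : #|ball h|%:R != 0 :> R[i] by rewrite pnatr_eq0 -lt0n ball_gt0.
transitivity ((n.+1%:R * #|ball h|%:R)^-1 * \sum_(u in ball h)
    \sum_(v in ball (h + T)) \sum_w omega R (x + u + v) w).
  under eq_bigr do rewrite /vp_kernel -mulrA.
  rewrite -mulr_sumr; congr (_ * _).
  under [RHS]eq_bigr do rewrite exchange_big /=.
  rewrite [RHS]exchange_big /=; apply: eq_bigr => w _.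
  rewrite /dirichlet [X in X * _]mulrC -mulrA mulr_suml; apply: eq_bigr => u _.
  rewrite mulr_suml mulr_sumr; apply: eq_bigr => v _.
  by rewrite !omegaDl !(omegaC _ _ w); ring.
rewrite rmorphM fmorphV !rmorph_nat.
suff -> : \sum_(u in ball h) \sum_(v in ball (h + T)) \sum_w omega R (x + u + v) w =
    n.+1%:R * #|[set u in ball h | - x - u \in ball (h + T)]|%:R.
  by rewrite invfM mulrACA mulVf // mul1r mulrC.
rewrite -sum1_card natr_sum mulr_sumr [RHS]big_mkcond [LHS]big_mkcond.
apply: eq_bigr => u _; rewrite [in RHS]inE /=; case: ifP => //= uh.
under eq_bigr do rewrite sum_omega.
rewrite -big_mkcondr /= mulr1.
have vE v : (x + u + v == 0) = (v == - x - u).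
  by rewrite addrC addr_eq0 opprD.
under eq_bigl do rewrite vE.
case: ifP => vh.
  by rewrite (big_pred1 (- x - u)) // => v; apply/andb_idl => /eqP ->.
by rewrite big1 // => v /andP[+ /eqP e]; rewrite e vh.
Qed.

(** The kernel is a product of two Dirichlet sums, so the discrete product rule and Cauchy-Schwarz
    reduce its l1 variation to the l2 norms of these sums and of their differences. *)
Lemma vp_kernel_variation a :
  \sum_w normc (vp_kernel (w + a) - vp_kernel w) <=
  7 * pi * T%:R * a%:R / n.+1%:R.
Proof.
set P := dirichlet (ball (h + T)); set Q := dirichlet (ball h).
pose th (r : nat) : R := 2 * pi * r%:R * a%:R / n.+1%:R.
have th0 r : 0 <= th r by rewrite !(mulr_ge0, invr_ge0) ?pi_ge0.
have D0 : 0 < n.+1%:R :> R by rewrite ltr0n.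
have M0 : 0 < #|ball h|%:R :> R by rewrite ltr0n ball_gt0.
pose s : R := Num.sqrt (n.+1%:R * #|ball h|%:R).
have s2 : s ^+ 2 = n.+1%:R * #|ball h|%:R by rewrite sqr_sqrtr // mulr_ge0 ?ltW.
have s0 : 0 <= s by apply: sqrtr_ge0.
(* [7 / 4] is a rational upper bound for the square root of the covering number [3]. *)
have cI : #|ball (h + T)|%:R <= (7 / 4) ^+ 2 * #|ball h|%:R :> R.
  have := card_ball; rewrite -(ler_nat R) natrM => c; lra.
have P2 : \sum_w normc (P w) ^+ 2 <= (7 / 4 * s) ^+ 2.
  by rewrite dirichlet_sqnorm exprMn s2 mulrCA ler_pM2l.
have Q2 : \sum_w normc (Q (w + a)) ^+ 2 <= s ^+ 2.
  rewrite -(reindex_inj (addIr a) (F := fun w => normc (Q w) ^+ 2) (P := xpredT)).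
  by rewrite dirichlet_sqnorm s2.
have dP : \sum_w normc (P (w + a) - P w) ^+ 2 <= (7 / 4 * s * th (h + T)%N) ^+ 2.
  apply: (le_trans (@dirichlet_shift_sqnorm _ a (h + T) _)).
    by move=> u; rewrite inE.
  rewrite [leRHS]exprMn -/(th _) ler_wpM2r ?sqr_ge0 //.
  by rewrite exprMn s2 mulrCA ler_pM2l.
have dQ : \sum_w normc (Q (w + a) - Q w) ^+ 2 <= (s * th h) ^+ 2.
  apply: (le_trans (@dirichlet_shift_sqnorm _ a h _)).
    by move=> u; rewrite inE.
  by rewrite [leRHS]exprMn s2.
have s740 : 0 <= 7 / 4 * s by apply: mulr_ge0 => //; lra.
have c1 := cauchy_schwarz_bound (mulr_ge0 s740 (th0 _)) s0 dP Q2.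
have c2 := cauchy_schwarz_bound s740 (mulr_ge0 s0 (th0 _)) P2 dQ.
apply: (@le_trans _ _ ((s ^+ 2)^-1 *
   (\sum_w normc (P (w + a) - P w) * normc (Q (w + a)) +
    \sum_w normc (P w) * normc (Q (w + a) - Q w)))).
  rewrite -big_split mulr_sumr; apply: ler_sum => w _.
  rewrite /vp_kernel -mulrBr normcM.
  have -> : normc (n.+1%:R * #|ball h|%:R)^-1 = (s ^+ 2)^-1.
    rewrite s2 normcV; congr (_^-1).
    by rewrite normcM !normc_nat.
  rewrite ler_wpM2l ?invr_ge0 ?sqr_ge0 // -!normcM -/P -/Q.
  apply: le_trans (le_normcD _ _); rewrite le_eqVlt; apply/predU1P; left.
  by congr normc; ring.
have s20 : 0 < s ^+ 2 by rewrite s2 mulr_gt0.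
rewrite ler_pdivrMl //; apply: le_trans (lerD c1 c2) _.
have -> : 7 / 4 * s * th (h + T)%N * s + 7 / 4 * s * (s * th h) =
  s ^+ 2 * (7 / 4 * (th (h + T)%N + th h)) by ring.
rewrite ler_pM2l //.
have -> : 7 / 4 * (th (h + T)%N + th h) =
  7 / 2 * pi * (h + T + h)%:R * a%:R / n.+1%:R.
  by rewrite /th !natrD; field; rewrite nat1r pnatr_eq0.
rewrite ler_wpM2r ?invr_ge0 // ler_wpM2r //.
have hT : (h + T + h)%:R <= 2 * T%:R :> R by rewrite -natrM ler_nat half_bound.
have := ler_wpM2l (pi_ge0 R) hT; lra.
Qed.

End Kernel.

(** * The Zak transform *)

Section Single.
Variables n l : nat.
Implicit Types (k : 'I_l) (a b : 'I_n.+1).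

Definition single k a : {ffun 'I_l -> 'I_n.+1} :=
  [ffun i => if i == k then a else 0].

Lemma singleD k a b : single k (a + b) = single k a + single k b.
Proof. by apply/ffunP => i; rewrite !ffunE; case: ifP; rewrite ?addr0. Qed.

Lemma single0 k : single k 0 = 0.
Proof. by apply/ffunP => i; rewrite !ffunE; case: ifP. Qed.

Lemma chi_single (R : realType) k a (u : {ffun 'I_l -> 'I_n.+1}) :
  chi R (single k a) u = omega R a (u k).
Proof.
rewrite /chi (bigD1 k) //= ffunE eqxx big1 ?mulr1 // => i ik.
by rewrite ffunE (negPf ik) omega0l.
Qed.

End Single.

Lemma inZpD n (a b : nat) : inZp (a + b) = inZp a + inZp b :> 'I_n.+1.
Proof. by apply: val_inj; rewrite /= modnDm. Qed.

Section Zak.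
Variables (R : realType) (m n l : nat).
Hypothesis nE : n.+1 = (m.+1 * m.+1)%N.

Local Notation N := m.+1.
Local Notation d := n.+1.
Local Notation VN := {ffun 'I_l -> 'I_N}.
Local Notation Vd := {ffun 'I_l -> 'I_d}.
Implicit Types (b f : Vd -> R[i]) (j : Vd) (y p q : VN) (k : 'I_l).

Let N_dvd : (N %| d)%N.
Proof. by rewrite nE dvdn_mulr. Qed.

Definition embed p : Vd := [ffun i => inZp (N * p i)].
Definition reduce j : VN := [ffun i => inZp (j i)].

Lemma embedD p q : embed (p + q) = embed p + embed q.
Proof.
apply/ffunP => i; rewrite !ffunE; apply: val_inj => /=.
by rewrite nE -muln_modr modnDm -mulnDr -muln_modr modn_mod.
Qed.

Lemma embed0 : embed 0 = 0.
Proof. by apply: (addrI (embed 0)); rewrite -embedD !addr0. Qed.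

Lemma reduceD j j' : reduce (j + j') = reduce j + reduce j'.
Proof.
apply/ffunP => i; rewrite !ffunE; apply: val_inj => /=.
by rewrite modn_dvdm ?N_dvd // modnDm.
Qed.

Lemma reduce_embed p : reduce (embed p) = 0.
Proof.
apply/ffunP => i; rewrite !ffunE; apply: val_inj => /=.
by rewrite nE -muln_modr modnMr.
Qed.

(** The kernel of [reduce] is the image of [embed], so each fibre is a coset; dividing [j - j0] by
    [N] recovers [p]. *)
Lemma sum_reduce_fiber (F : Vd -> R) (j0 : Vd) :
  \sum_(j | reduce j == reduce j0) F j = \sum_p F (j0 + embed p).
Proof.
pose div_fiber j : VN := [ffun i => inZp (((j - j0)%R i) %/ N)%N].
rewrite (reindex_onto (fun p => j0 + embed p) div_fiber) /=.
  apply: eq_bigl => p; rewrite reduceD reduce_embed addr0 eqxx /=.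
  apply/eqP/ffunP => i; rewrite /div_fiber addrAC subrr add0r !ffunE.
  by apply: val_inj => /=; rewrite nE -muln_modr mulKn // modn_mod modn_small.
move=> j /eqP jE; apply/eqP; rewrite addrC eq_sym -subr_eq eq_sym; apply/eqP.
have : reduce (j - j0) = 0.
  by apply: (addIr (reduce j0)); rewrite -reduceD subrK add0r.
rewrite /div_fiber; move: (j - j0) => v /ffunP r0; apply/ffunP => i.
move: (r0 i); rewrite !ffunE; move: (v i) => u /(congr1 val) /= uN.
apply: val_inj => /=; have := ltn_ord u; rewrite [X in (_ < X)%N]nE => ult.
rewrite [(u %/ N %% N)%N]modn_small; last by rewrite ltn_divLR.
by rewrite mulnC (divnK (_ : N %| u)%N) ?modn_small // /dvdn uN.
Qed.

Lemma omega_embed (a : 'I_d) (c : 'I_N) :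
  omega R a (inZp (N * c)) = omega R (inZp a : 'I_N) c.
Proof.
rewrite /omega (eq_unit_root _ (_ : _ = N * (a * c) %[mod d])%N); last first.
  by rewrite /= modnMmr; congr (_ %% _)%N; lia.
have -> e : unit_root R d (N * e)%N = unit_root R N e by rewrite nE unit_rootMl.
apply: eq_unit_root.
by rewrite /= modnMml.
Qed.

(** Unnormalised, and taken at every [j] rather than on a fundamental domain, so that translating
    [j] needs no case distinction; [zak_embed] is the quasiperiodicity. *)
Definition zak b j y : R[i] := \sum_p b (j - embed p) * chi R p y.

Lemma zak_embed b j y q : zak b (j + embed q) y = chi R q y * zak b j y.
Proof.
rewrite /zak (reindex_inj (addIr q)) mulr_sumr; apply: eq_bigr => p _.
by rewrite embedD chiDl [embed p + _]addrC addrKA; ring.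
Qed.

Lemma zakB b f j y : zak (fun i => b i - f i) j y = zak b j y - zak f j y.
Proof. by rewrite /zak -sumrB; apply: eq_bigr => p _; rewrite mulrBl. Qed.

(** Parseval in [y] gives one factor [N ^ l]; the other arises because the sum over all [j] counts
    every value of [f] once for each [p]. *)
Lemma zak_sqnorm f :
  \sum_j \sum_y normc (zak f j y) ^+ 2 =
  N%:R ^+ l * N%:R ^+ l * \sum_j normc (f j) ^+ 2.
Proof.
under eq_bigr do rewrite (@parseval_chi R m l (fun p => f (_ - embed p))).
rewrite -mulr_sumr exchange_big -mulrA /=; congr (_ * _).
rewrite (eq_bigr (fun=> \sum_j normc (f j) ^+ 2)).
  by rewrite sumr_const card_ffun !card_ord -[LHS]mulr_natl natrX.
by move=> p _; rewrite [RHS](reindex_inj (addIr (- embed p))).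
Qed.

Definition convolve (kap : 'I_d -> R[i]) k b j : R[i] :=
  \sum_w kap w * b (j - single k w).

Lemma zak_convolve kap k b j y :
  zak (convolve kap k b) j y = \sum_w kap w * zak b (j - single k w) y.
Proof.
rewrite /zak /convolve; under eq_bigr do rewrite mulr_suml.
rewrite exchange_big; apply: eq_bigr => w _.
by rewrite mulr_sumr; apply: eq_bigr => p _; rewrite mulrA addrAC.
Qed.

Definition modulate (kap : 'I_d -> R[i]) k b j : R[i] :=
  (\sum_w kap w * omega R w (j k)) * b j.

(** Multiplying [b] by a character of [j k] translates its Zak transform in [y k] up to a phase, so
    cutting off in space is an averaging in the second variable. *)
Lemma zak_modulate kap k b j y :
  zak (modulate kap k b) j y =
  \sum_w kap w * omega R w (j k) * zak b j (y - single k (inZp w)).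
Proof.
rewrite /zak /modulate; under eq_bigr do rewrite !mulr_suml.
rewrite exchange_big; apply: eq_bigr => w _.
rewrite mulr_sumr; apply: eq_bigr => p _.
rewrite chiDr -[chi R p (- _)]chiC chiNl chi_single -omega_embed !ffunE omegaDr omegaNr.
by ring.
Qed.

Section Shift.
Variables (kap : 'I_d -> R[i]) (k : 'I_l) (b : Vd -> R[i]) (S : R).
Hypothesis zakS : forall j y, normc (zak b j y) <= S.
Let variation a : R := \sum_w normc (kap (w + a) - kap w).

Lemma zak_convolve_shift (a : 'I_d) j y :
  normc (zak (convolve kap k b) (j + single k a) y - zak (convolve kap k b) j y)
  <= variation a * S.
Proof.
rewrite !zak_convolve (reindex_inj (addIr a)) -sumrB mulr_suml /=.
apply: le_trans (ler_normc_sum _ _ _) _; apply: ler_sum => w _.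
by rewrite singleD [single k _ + single k _]addrC addrKA -mulrBl normcM ler_wpM2l ?normc_ge0.
Qed.

(** As for [convolve], reindexing moves the shift onto the kernel. The leftover phase
    [omega R a (j k)] is the one carried by the vertical edges in the winding argument. *)
Lemma zak_modulate_shift (a : 'I_d) j y :
  normc (zak (modulate kap k b) j (y + single k (inZp a)) -
         omega R a (j k) * zak (modulate kap k b) j y)
  <= variation a * S.
Proof.
rewrite !zak_modulate (reindex_inj (addIr a)) mulr_sumr -sumrB mulr_suml /=.
apply: le_trans (ler_normc_sum _ _ _) _; apply: ler_sum => w _.
have -> : inZp (w + a)%R = inZp w + inZp a :> 'I_N.
  by apply: val_inj; rewrite /= modn_dvdm ?N_dvd // modnDm.
rewrite singleD [single k _ + single k _]addrC addrKA omegaDl.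
set z := zak _ _ _.
have -> : kap (w + a) * (omega R w (j k) * omega R a (j k)) * z -
    omega R a (j k) * (kap w * omega R w (j k) * z) =
    (kap (w + a) - kap w) * (omega R w (j k) * omega R a (j k) * z) by ring.
rewrite !normcM !normc_omega !mul1r ler_wpM2l ?normc_ge0 //; exact: zakS.
Qed.

End Shift.

(** * Energy of the two residuals on a grid *)

Section Grid.
Variables (k : 'I_l) (b b1 b2 : Vd -> R[i]) (A eps del : R) (K L : nat).
Variables s t : nat -> nat.
Hypotheses (A0 : 0 < A) (zakA : forall j y, A <= normc (zak b j y)).
Hypothesis small : eps + 2 * del < A.
Hypotheses (s_mono : forall i, (s i <= s i.+1)%N) (t_mono : forall i, (t i <= t i.+1)%N).
Hypotheses (s_half : forall i, (2 * (s i.+1 - s i) <= N)%N).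
Hypotheses (t_half : forall i, (2 * (t i.+1 - t i) <= N)%N).
Hypotheses (s0 : s 0%N = 0%N) (t0 : t 0%N = 0%N) (sK : s K = N) (tL : t L = N).
Hypothesis shift1 : forall i j y,
  normc (zak b1 (j + single k (inZp (s i.+1 - s i))) y - zak b1 j y) <= eps.
Hypothesis shift2 : forall i j y,
  normc (zak b2 j (y + single k (inZp (inZp (t i.+1 - t i) : 'I_d))) -
    omega R (inZp (t i.+1 - t i)) (j k) * zak b2 j y) <= eps.

Let energy j y : R := normc (zak (fun i => b i - b1 i) j y) ^+ 2 +
  normc (zak (fun i => b i - b2 i) j y) ^+ 2.

(** Otherwise both modifications stay within [del] of [zak b] at every grid point, so along each
    edge [zak b] moves by less than [eps + 2 * del < A], up to the phase. Being at least [A] in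
    modulus it turns by less than [pi / 3], which [no_quasiperiodic_section] forbids. *)
Lemma energy_grid j y : 0 <= del ->
  del ^+ 2 <= \sum_(i < K.+1) \sum_(i' < L.+1)
    energy (j + single k (inZp (s i))) (y + single k (inZp (t i'))).
Proof.
move=> del0; rewrite leNgt; apply/negP => sum_lt.
pose P i := j + single k (inZp (s i)); pose Q i := y + single k (inZp (t i)).
have energy_ge0 j' y' : 0 <= energy j' y' by rewrite addr_ge0 ?sqr_ge0.
have e_lt i i' : (i <= K)%N -> (i' <= L)%N -> energy (P i) (Q i') < del ^+ 2.
  move=> iK iL; apply: le_lt_trans sum_lt.
  rewrite (bigD1 (Ordinal (iK : (i < K.+1)%N))) //= (bigD1 (Ordinal (iL : (i' < L.+1)%N))) //=.
  rewrite -addrA lerDl addr_ge0 ?sumr_ge0 // => i1 _; apply: sumr_ge0 => *; exact: energy_ge0.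
have close1 i i' : (i <= K)%N -> (i' <= L)%N ->
    normc (zak b (P i) (Q i') - zak b1 (P i) (Q i')) < del.
  move=> iK iL; rewrite -zakB -(@ltr_pXn2r _ 2) ?nnegrE ?normc_ge0 //.
  by apply: le_lt_trans (e_lt _ _ iK iL); rewrite lerDl sqr_ge0.
have close2 i i' : (i <= K)%N -> (i' <= L)%N ->
    normc (zak b (P i) (Q i') - zak b2 (P i) (Q i')) < del.
  move=> iK iL; rewrite -zakB -(@ltr_pXn2r _ 2) ?nnegrE ?normc_ge0 //.
  by apply: le_lt_trans (e_lt _ _ iK iL); rewrite lerDr sqr_ge0.
have zak_neq0 j' y' : zak b j' y' != 0.
  by rewrite -normc_eq0 gt_eqF // (lt_le_trans A0).
have N0 : N%:R != 0 :> R by rewrite pnatr_eq0.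
have nER : d%:R = N%:R * N%:R :> R by rewrite nE natrM.
have tri (z1 z2 z3 z4 : R[i]) : normc (z1 - z4) <=
    normc (z1 - z2) + normc (z2 - z3) + normc (z3 - z4).
  have -> : z1 - z4 = (z1 - z2) + (z2 - z3) + (z3 - z4) by ring.
  by apply: le_trans (le_normcD _ _) _; rewrite lerD2r le_normcD.
have sum3 (x1 x2 x3 : R) : x2 <= eps -> x1 < del -> x3 < del -> x1 + x2 + x3 < A.
  by have := small; lra.
(* The positions are real lifts, not reduced modulo the torus, so that each coordinate advances by
   exactly one. *)
apply: (@no_quasiperiodic_section R K L
  (fun i => (j k + s i)%N%:R / N%:R) (fun i => (y k + t i)%N%:R / N%:R)
  (fun i i' => zak b (P i) (Q i'))) => //.
- move=> i i' iK iL; apply: (normc_ratio_lt A0) => //.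
  have PS : P i.+1 = P i + single k (inZp (s i.+1 - s i)).
    by rewrite /P -addrA -singleD -inZpD subnKC.
  apply: le_lt_trans (tri _ (zak b1 (P i.+1) (Q i')) (zak b1 (P i) (Q i')) _) _.
  move: (close1 i.+1 i' iK iL) (close1 i i' (ltnW iK) iL).
  by have := shift1 i (P i) (Q i'); rewrite -PS [normc (zak b1 _ _ - zak b _ _)]normcB; apply: sum3.
- move=> i i' iK iL.
  (* Since [d = N * N], the curvature phase of a step is the character [omega] of [Z_d] at the
     current point. *)
  have twE : expi (2 * pi * (((y k + t i'.+1)%N%:R / N%:R - (y k + t i')%N%:R / N%:R) *
     ((j k + s i)%N%:R / N%:R))) = omega R (inZp (t i'.+1 - t i')) (P i k).
    rewrite /P !ffunE eqxx /omega /=.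
    rewrite (eq_unit_root _ (_ : _ = (t i'.+1 - t i') * (j k + s i) %[mod d])%N); last first.
      by rewrite modnMml modnMmr -modnMmr modnDmr modnMmr.
    rewrite /unit_root; congr expi; rewrite nER natrM natrB // !natrD; field.
    by rewrite nat1r N0.
  rewrite twE; apply: (normc_ratio_lt A0) => //.
    by rewrite normcM normc_omega mul1r.
  have QS : Q i'.+1 = Q i' + single k (inZp (inZp (t i'.+1 - t i') : 'I_d)).
    rewrite /Q -addrA -singleD; congr (_ + single k _).
    rewrite -[in LHS](subnKC (t_mono i')) inZpD; congr (_ + _).
    by apply: val_inj; rewrite /= modn_dvdm ?N_dvd.
  set w := omega R _ _.
  apply: le_lt_trans (tri _ (zak b2 (P i) (Q i'.+1)) (w * zak b2 (P i) (Q i')) _) _.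
  move: (close2 i i'.+1 iK iL) (close2 i i' iK (ltnW iL)).
  have := shift2 i' (P i) (Q i'); rewrite -QS -/w -mulrBr normcM normc_omega mul1r.
  by rewrite [normc (zak b2 _ _ - zak b _ _)]normcB; apply: sum3.
- move=> i i' iK iL.
  (* Both sides of a cell are at most [1 / 2], so its area is at most [1 / 4 < 1 / 3]. *)
  have step (u : nat -> nat) (c : nat) : (forall i, (u i <= u i.+1)%N) ->
      (forall i, (2 * (u i.+1 - u i) <= N)%N) -> forall i0,
      0 <= ((c + u i0.+1)%N%:R / N%:R - (c + u i0)%N%:R / N%:R : R) <= 1 / 2.
    move=> mono half i0.
    have -> : (c + u i0.+1)%N%:R / N%:R - (c + u i0)%N%:R / N%:R =
      (u i0.+1 - u i0)%N%:R / N%:R :> R by rewrite natrB // !natrD -mulrBl; congr (_ / _); ring.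
    apply/andP; split; first by apply: divr_ge0.
    rewrite ler_pdivrMr ?ltr0n //.
    by have := half i0; rewrite -(ler_nat R) natrM; lra.
  have /andP[x0 x1] := step s (j k) s_mono s_half i.
  have /andP[y0 y1] := step t (y k) t_mono t_half i'.
  apply/andP; split; first exact: mulr_ge0.
  by apply: le_lt_trans (ler_pM x0 y0 x1 y1) _; lra.
- move=> i; rewrite /Q tL t0; congr (zak _ _ (_ + single k _)).
  by apply: val_inj; rewrite /= modnn mod0n.
- move=> i'; rewrite /P sK s0.
  have -> : inZp 0 = 0 :> 'I_d by apply: val_inj; rewrite /= mod0n.
  rewrite single0 addr0.
  (* A full turn in [j k] is a translation by the subgroup, so quasiperiodicity supplies the
     phase. *)
  have -> : single k (inZp N) = embed (single k (inZp 1)).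
    apply/ffunP => i; rewrite !ffunE; case: eqP => _; apply: val_inj => /=;
      rewrite ?muln0 ?mod0n //.
    by rewrite nE muln_modr muln1 modn_mod.
  rewrite zak_embed chi_single /Q !ffunE eqxx; congr (_ * _).
  rewrite /omega /unit_root -/(unit_root R _ _).
  rewrite (eq_unit_root _ (_ : _ = (y k + t i')%N %[mod N])%N).
    by rewrite /unit_root; congr expi; ring.
  by rewrite /= modnMml mul1n modn_mod modnDmr.
- by rewrite sK s0 addn0 natrD; field; rewrite nat1r.
- by rewrite tL t0 addn0 natrD; field; rewrite nat1r.
Qed.

(** Sum [energy_grid] over all base points: by translation invariance each of the [K.+1 * L.+1] grid
    points contributes the full energy, which [zak_sqnorm] evaluates. *)
Lemma sqdist_ge : 0 <= del ->
  del ^+ 2 * N%:R ^+ l <= K.+1%:R * L.+1%:R *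
    (\sum_j normc (b j - b1 j) ^+ 2 + \sum_j normc (b j - b2 j) ^+ 2).
Proof.
move=> del0.
have NE : 0 < N%:R ^+ l :> R by rewrite exprn_gt0 ?ltr0n.
have cardVd : #|{: Vd}|%:R = N%:R ^+ l * N%:R ^+ l :> R.
  by rewrite card_ffun !card_ord nE expnMn natrM natrX.
have cardVN : #|{: VN}|%:R = N%:R ^+ l :> R.
  by rewrite card_ffun !card_ord natrX.
have : \sum_(j : Vd) \sum_(y : VN) del ^+ 2 <= \sum_(j : Vd) \sum_(y : VN)
   \sum_(i < K.+1) \sum_(i' < L.+1)
    energy (j + single k (inZp (s i))) (y + single k (inZp (t i'))).
  by apply: ler_sum => j _; apply: ler_sum => y _; apply: energy_grid.
have -> : \sum_(j : Vd) \sum_(y : VN) del ^+ 2 = N%:R ^+ l * N%:R ^+ l * (N%:R ^+ l * del ^+ 2).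
  by rewrite !sumr_const -[LHS]mulr_natl -[X in _ * X]mulr_natl cardVd cardVN.
have -> : \sum_(j : Vd) \sum_(y : VN) \sum_(i < K.+1) \sum_(i' < L.+1)
    energy (j + single k (inZp (s i))) (y + single k (inZp (t i'))) =
  \sum_(i < K.+1) \sum_(i' < L.+1) \sum_j \sum_y energy j y.
  under eq_bigr do rewrite exchange_big /=.
  rewrite exchange_big; apply: eq_bigr => i _ /=.
  under eq_bigr do rewrite exchange_big /=.
  rewrite exchange_big; apply: eq_bigr => i' _ /=.
  rewrite [RHS](reindex_inj (addIr (single k (inZp (s i))))).
  by apply: eq_bigr => j _; rewrite [RHS](reindex_inj (addIr (single k (inZp (t i'))))).
have -> : \sum_j \sum_y energy j y = N%:R ^+ l * N%:R ^+ l *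
    (\sum_j normc (b j - b1 j) ^+ 2 + \sum_j normc (b j - b2 j) ^+ 2).
  rewrite mulrDr -!zak_sqnorm -big_split; apply: eq_bigr => j _ /=.
  by rewrite -big_split.
rewrite !sumr_const !card_ord -[leRHS]mulr_natl -[X in _ <= _ * X]mulr_natl.
rewrite [X in _ <= _ * X]mulrCA [leRHS]mulrCA.
rewrite ler_pM2l ?mulr_gt0 // [_ * del ^+ 2]mulrC.
by move=> h; rewrite -mulrA.
Qed.

End Grid.
End Zak.

(** * Gabor systems and the discrete Fourier transform *)

Section Phases.
Variable R : realType.

Lemma expi_2pi_int (z : int) : expi (2 * pi * z%:~R : R) = 1.
Proof.
case: z => n; first by rewrite expi_2pi_nat.
by rewrite NegzE rmorphN mulrN expiN expi_2pi_nat invr1.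
Qed.

(** Representatives differ by a multiple of [d], hence of [e]. The case [e = N] serves the Gabor
    atoms, [e = d] the Fourier transform. *)
Lemma expi_centered (d e : nat) (u : Zmod d) (z : int) : (0 < e)%N -> (e %| d)%N ->
  expi (2 * pi * (centered u * z)%:~R / e%:R) =
  expi (2 * pi * (u%:Z * z)%:~R / e%:R) :> R[i].
Proof.
move=> e0 /dvdnP[c dE]; rewrite /centered; case: ifP => // _.
rewrite -[RHS]mul1r -(expi_2pi_int (- (c%:Z * z))) -expiD; congr expi.
move: (nat_of_ord u) => a.
by rewrite dE PoszM !(rmorphM, rmorphB, rmorphN) /=; field; rewrite pnatr_eq0 -lt0n.
Qed.

Lemma expi_sum (I : finType) (F : I -> int) (c : R) :
  expi (c * (\sum_i F i)%:~R) = \prod_i expi (c * (F i)%:~R).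
Proof.
rewrite rmorph_sum mulr_sumr /=.
by apply: (big_morph (@expi R)) => [x y|]; rewrite ?expiD ?expi0.
Qed.

End Phases.

Section GaborSystem.
Variables (R : realType) (m l : nat).
Local Notation N := m.+1.
Local Notation n := (N ^ 2).-1.
Local Notation VN := {ffun 'I_l -> 'I_N}.
Local Notation Vd := {ffun 'I_l -> 'I_n.+1}.
Implicit Types (b : ell2 R N l) (j : Vd) (p q y : VN).

Let dE : n.+1 = (N ^ 2)%N.
Proof. by rewrite prednK // expn_gt0. Qed.

Lemma sqr_dim : n.+1 = (N * N)%N.
Proof. by rewrite dE mulnn. Qed.

Let dRE : n.+1%:R ^+ l = N%:R ^+ l * N%:R ^+ l :> R.
Proof. by rewrite sqr_dim natrM exprMn. Qed.

Lemma gabor_atomE b p q j :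
  gabor_atom b (p, q) j = b (j - embed n p) * chi R (reduce m j) q.
Proof.
rewrite ffunE /=; congr (_ * _).
rewrite mulrAC expi_sum /chi; apply: eq_bigr => i _.
rewrite mulrAC expi_centered //; last by rewrite dvdn_exp.
rewrite /omega ffunE (eq_unit_root _ (_ : _ = j i * q i %[mod N])%N) //.
by rewrite /= modnMml.
Qed.

Lemma dftE b j :
  dft b j = (N%:R ^+ l)^-1 * \sum_i b i * chi R i (- j).
Proof.
rewrite ffunE; congr (_ * _); apply: eq_bigr => i _; congr (_ * _).
rewrite expiN chiC chiNl chiC; congr (_^-1).
rewrite mulrAC expi_sum /chi; apply: eq_bigr => c _.
rewrite mulrAC expi_centered // [Posz _ * _]mulrC expi_centered //.
rewrite /omega /unit_root -PoszM mulnC.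
by move: (i c * j c)%N => a; rewrite dE.
Qed.

Lemma dft_parseval b :
  \sum_j normc (dft b j) ^+ 2 = \sum_j normc (b j) ^+ 2.
Proof.
rewrite [LHS](reindex_inj (@oppr_inj Vd)) /=.
under eq_bigr do rewrite dftE opprK normcM exprMn.
rewrite -mulr_sumr parseval_chi dRE normcV -natrX normc_nat natrX.
have : N%:R ^+ l != 0 :> R by rewrite expf_neq0 // pnatr_eq0.
by move: (N%:R ^+ l : R) => D D0; field.
Qed.

Lemma riesz_zak_bounds (A B : R) b : gabor_riesz_basis A B b ->
  forall j y, A <= normc (zak b j y) ^+ 2 <= B.
Proof.
case=> _ riesz j0 y.
(* The first character synthesises the Zak transform at [y]; the second, summed over modulations,
   concentrates it on the coset of [j0], where its modulus is constant by quasiperiodicity. *)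
pose c (nm : gabor_index N l) : R[i] := chi R nm.1 y * chi R (- reduce m j0) nm.2.
have cardVN : #|{: VN}|%:R = N%:R ^+ l :> R.
  by rewrite card_ffun !card_ord natrX.
have sc : \sum_nm normc (c nm) ^+ 2 = N%:R ^+ l * N%:R ^+ l.
  under eq_bigr do rewrite normcM !normc_chi mul1r expr1n.
  by rewrite sumr_const card_prod natrM cardVN.
have comb j : (\sum_nm c nm *: gabor_atom b nm) j =
    zak b j y * (if reduce m j == reduce m j0 then N%:R ^+ l else 0).
  rewrite -subr_eq0 -sum_chi sum_ffunE /zak mulr_suml.
  under [RHS]eq_bigr do rewrite mulr_sumr.
  rewrite pair_big /=; apply: eq_bigr => -[p q] _.
  rewrite ffunE gabor_atomE /c /= chiDl /GRing.scale /=; ring.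
have := riesz c; rewrite /= sc.
have -> : ell2_sqnorm (\sum_nm c nm *: gabor_atom b nm) =
    normc (zak b j0 y) ^+ 2 * (N%:R ^+ l * N%:R ^+ l).
  rewrite /ell2_sqnorm.
  under eq_bigr do rewrite comb.
  transitivity ((N%:R ^+ l)^-1 * \sum_(j | reduce m j == reduce m j0)
      (normc (zak b j y) ^+ 2 * (N%:R ^+ l * N%:R ^+ l))).
    congr (_ * _); rewrite [RHS]big_mkcond; apply: eq_bigr => j _.
    case: ifP => _; last by rewrite mulr0 normc0 expr0n.
    by rewrite normcM -natrX normc_nat natrX exprMn expr2.
  rewrite (sum_reduce_fiber sqr_dim).
  under eq_bigr do rewrite (zak_embed sqr_dim) normcM normc_chi mul1r.
  rewrite sumr_const -[X in _ * X]mulr_natl cardVN.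

  by rewrite mulKf // expf_neq0 // pnatr_eq0.
by rewrite !ler_pM2r // mulr_gt0 // exprn_gt0 ?ltr0n.
Qed.

Lemma dft_convolve_residual (kap : 'I_n.+1 -> R[i]) (k : 'I_l) b j :
  dft [ffun i => b i - convolve kap k b i] j =
  (1 - \sum_w kap w * omega R w (- j k)) * dft b j.
Proof.
rewrite !dftE mulrBl mul1r mulrCA -mulrBr; congr (_ * _).
under eq_bigr do rewrite ffunE mulrBl.
rewrite sumrB; congr (_ - _); rewrite /convolve mulr_suml.
under eq_bigr do rewrite mulr_suml.
rewrite exchange_big; apply: eq_bigr => w _.
rewrite (reindex_inj (addIr (single k w))) mulr_sumr; apply: eq_bigr => i _ /=.
by rewrite addrK chiDl chi_single ffunE; ring.
Qed.

(** The factor [1 - mu] lies in [[0, 1]] and vanishes off the tail. *)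
Lemma residual_tail (F : ell2 R N l) (k : 'I_l) (r : nat) (mu : Vd -> R) :
  (forall j, 0 <= mu j <= 1) ->
  (forall j, (cyc_norm (j k) <= (N * r)./2)%N -> mu j = 1) ->
  \sum_j normc ((1 - (mu j)%:C%C) * F j) ^+ 2 <=
  N%:R ^+ l * tail F k (N%:R * r%:R / 2).
Proof.
move=> mu01 mu1; rewrite /tail mulrA divff ?mul1r; last by rewrite expf_neq0 // pnatr_eq0.
rewrite [leRHS]big_mkcond; apply: ler_sum => j _.
rewrite -(rmorph1 (real_complex R)) -rmorphB normcM normc_real.
case: ifPn => [_|]; last first.
  rewrite -intr_norm -abszE -pmulrn abs_centered ?expn_gt0 // -ltNge => h.
  rewrite mu1 ?subrr ?normr0 ?mul0r ?expr0n //.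
  (* Off the tail the inequality is strict, so rounding [N * r / 2] down loses no point. *)
  have : (2 * cyc_norm (j k) < N * r)%N by rewrite -(ltr_nat R) !natrM; lra.
  by move: (cyc_norm _) (N * r)%N => c e; lia.
have /andP[? ?] := mu01 j.
rewrite exprMn ler_piMl ?sqr_ge0 // expr_le1 // ger0_norm; lra.
Qed.

End GaborSystem.

(** * Choice of the grid and the final estimate *)

Section Scales.
Variable R : realType.

Lemma grid_step (N q : nat) (rho : R) : 0 < rho <= 1 -> (1 <= q)%N ->
  q%:R <= N%:R / 16 * rho -> exists g K : nat,
  [/\ (2 * g <= N)%N, 16 * q%:R * g%:R <= N%:R * rho, (N <= K * g)%N
    & K.+1%:R * rho <= 64 * q%:R].
Proof.
move=> /andP[rho0 rho1] q1 qN.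
have q0 : 1 <= q%:R :> R by rewrite ler1n.
(* The ideal step. As [x >= 1], its floor [g] satisfies [x <= 2 * g]; with [K = N %/ g + 1] one has
   [K.+1 * g <= N + 2 * g <= 2 * N], so [K.+1 * x <= 4 * N], whence the constant [64]. *)
pose x : R := N%:R * rho / (16 * q%:R).
have xE : x * (16 * q%:R) = N%:R * rho by rewrite divfK //; lra.
have x1 : 1 <= x by rewrite ler_pdivlMr; lra.
pose g := Num.truncn x.
have /andP[gx xg] : g%:R <= x < g.+1%:R by apply: truncn_itv; lra.
have g1 : (1 <= g)%N by rewrite truncn_gt0.
have gN : 16 * q%:R * g%:R <= N%:R * rho by rewrite -xE mulrC ler_pM2r //; lra.
have g2N : (2 * g <= N)%N.
  rewrite -(ler_nat R) natrM.
  have : N%:R * rho <= N%:R by rewrite ler_piMr.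
  have : g%:R <= q%:R * g%:R :> R by rewrite ler_peMl.
  have : 0 <= N%:R :> R by [].
  lra.
exists g, (N %/ g).+1; split=> //.
  exact/ltnW/ltn_ceil.
have Kg : ((N %/ g).+2 * g <= 2 * N)%N by have := leq_divM N g; lia.
have x2g : x <= 2 * g%:R.
  by move: xg g1; rewrite -natr1 -(ler_nat R); lra.
have : (N %/ g).+2%:R * x <= 4 * N%:R :> R.
  move: Kg; rewrite -(ler_nat R) !natrM.
  have := ler_wpM2l (ler0n R (N %/ g).+2) x2g; lra.
have N0 : 0 < N%:R :> R.
  by rewrite ltr0n; lia.
rewrite -(ler_pM2r (_ : 0 < 16 * q%:R)); last by lra.
rewrite -mulrA xE => h.
by rewrite -(ler_pM2l N0); lra.
Qed.

Lemma variation_scale (N q g T a : nat) (rho : R) : (0 < N)%N ->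
  16 * q%:R * g%:R <= N%:R * rho -> (2 * T <= N * q)%N -> (a <= g)%N ->
  7 * pi * T%:R * a%:R / (N * N)%:R <= 7 / 8 * rho.
Proof.
move=> N0 gN TN ag.
have N0R : 0 < N%:R :> R by rewrite ltr0n.
rewrite ler_pdivrMr ?ltr0n ?muln_gt0 ?N0 //.
(* With this bound the left side is at most [14 * q * g / N], and [16 * q * g <= N * rho] gives
   [14 / 16 = 7 / 8]. *)
have p4 : pi <= 4 :> R by have := @pihalf_lt2 R; lra.
have Ta : 2 * (T%:R * a%:R) <= N%:R * q%:R * g%:R :> R.
  by rewrite -!natrM ler_nat mulnA leq_mul.
have h1 : pi * (T%:R * a%:R) <= 4 * (T%:R * a%:R) :> R by rewrite ler_wpM2r // -natrM.
have h2 : N%:R * (16 * q%:R * g%:R) <= N%:R * (N%:R * rho) by rewrite ler_pM2l.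
by rewrite natrM; lra.
Qed.

End Scales.

Lemma vp_residuals_ge (R : realType) (m n l : nat) (k : 'I_l)
    (b : {ffun 'I_l -> 'I_n.+1} -> R[i]) (alpha beta rho : R)
    (q r g g' K L : nat) (nE : n.+1 = (m.+1 * m.+1)%N) :
  0 < alpha ->
  (forall j y, alpha <= normc (zak (m := m) b j y)) ->
  (forall j y, normc (zak (m := m) b j y) <= beta) ->
  rho * beta = alpha ->
  (2 * g <= m.+1)%N -> 16 * q%:R * g%:R <= m.+1%:R * rho -> (m.+1 <= K * g)%N ->
  (2 * g' <= m.+1)%N -> 16 * r%:R * g'%:R <= m.+1%:R * rho -> (m.+1 <= L * g')%N ->
  (alpha / 20) ^+ 2 * m.+1%:R ^+ l <= K.+1%:R * L.+1%:R *
    (\sum_j normc (b j - convolve (vp_kernel R (m.+1 * q)./2) k b j) ^+ 2 +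
     \sum_j normc (b j - modulate (vp_kernel R (m.+1 * r)./2) k b j) ^+ 2).
Proof.
move=> a0 zakA zakB rhoB g2 gq NK g2' gr NL.
have beta0 : 0 <= beta by apply: le_trans (zakB 0 0); apply: normc_ge0.
have var (p h : nat) (a : 'I_n.+1) : 16 * p%:R * h%:R <= m.+1%:R * rho -> (a <= h)%N ->
    (\sum_w normc (vp_kernel R (m.+1 * p)./2 (w + a) - vp_kernel R (m.+1 * p)./2 w))
      * beta <= 7 / 8 * alpha.
  move=> hp ah; rewrite -rhoB mulrA ler_wpM2r //.
  apply: le_trans (vp_kernel_variation _ _ _) _.
  move: (nat_of_ord a) ah => c ch; rewrite nE; apply: variation_scale hp _ ch => //.
  by rewrite mul2n; lia.
have step_le (h i : nat) : (minn (i.+1 * h) m.+1 - minn (i * h) m.+1 <= h)%N.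
  by rewrite mulSn; lia.
have mono (h : nat) i : (minn (i * h) m.+1 <= minn (i.+1 * h) m.+1)%N.
  by rewrite mulSn; lia.
have half (h : nat) i : (2 * h <= m.+1)%N ->
    (2 * (minn (i.+1 * h) m.+1 - minn (i * h) m.+1) <= m.+1)%N.
  by have := step_le h i; lia.
(* Regular grids capped at [N], so a shorter last step closes the torus exactly. The tolerance
   [alpha / 20] fits because [7 / 8 + 2 / 20 < 1]. *)
apply: (@sqdist_ge R m n l nE k b _ _ alpha (7 / 8 * alpha) (alpha / 20) K L
  (fun i => minn (i * g) m.+1) (fun i => minn (i * g') m.+1)) => //.
- by lra.
- by move=> i; apply: half.
- by move=> i; apply: half.
- exact/minn_idPr.
- exact/minn_idPr.
- move=> i j y; apply: le_trans (zak_convolve_shift _ _ zakB _ _ _) _.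
  apply: var gq _; exact: leq_trans (leq_mod _ _) (step_le g i).
- move=> i j y; apply: le_trans (zak_modulate_shift nE _ _ zakB _ _ _) _.
  apply: var gr _; exact: leq_trans (leq_mod _ _) (step_le g' i).
- by lra.
Qed.

Theorem theorem1p7 (R : realType) (A B : R) (l : nat) :
  0 < A -> 0 < B ->
  exists C : R, 0 < C /\
    forall (N : nat) (b : ell2 R N l),
      200 * Num.sqrt (B / A) <= N%:R ->
      gabor_riesz_basis A B b ->
      forall (k : 'I_l) (q r : nat),
        (1 <= q)%N -> q%:R <= N%:R / 16 * Num.sqrt (A / B) ->
        (1 <= r)%N -> r%:R <= N%:R / 16 * Num.sqrt (A / B) ->
        C / (q%:R * r%:R) <=
          tail b k (N%:R * r%:R / 2) + tail (dft b) k (N%:R * q%:R / 2).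
Proof.
(* [20] comes from the tolerance [alpha / 20], [64] from the number of grid points in each
   direction, and [A / B] from [rho ^+ 2]. *)
move=> A0 B0; exists ((A / (20 * 64)) ^+ 2 / B); split.
  by rewrite divr_gt0 ?exprn_gt0 ?divr_gt0 ?mulr_gt0.
(* [N = 0] contradicts the positive lower bound on [N]. *)
case=> [b|m b _ riesz k q r q1 qN r1 rN].
  by rewrite leNgt mulr_gt0 ?sqrtr_gt0 ?divr_gt0.
have zakAB := riesz_zak_bounds riesz.
have sA0 : 0 < Num.sqrt A by rewrite sqrtr_gt0.
have sB0 : 0 < Num.sqrt B by rewrite sqrtr_gt0.
set rho := Num.sqrt (A / B) in qN rN.
have rhoB : rho * Num.sqrt B = Num.sqrt A.
  by rewrite /rho sqrtrM ?ltW // sqrtrV ?ltW // divfK // gt_eqF.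
have rho2 : rho ^+ 2 = A / B by rewrite sqr_sqrtr // divr_ge0 ?ltW.
have rho0 : 0 < rho by rewrite sqrtr_gt0 divr_gt0.
(* The Zak bounds at a single point already force [A <= B]. *)
have rho01 : 0 < rho <= 1.
  rewrite rho0 -sqrtr1 ler_sqrt // ler_pdivrMr // mul1r.
  by have /andP[] := zakAB 0 0; apply: le_trans.
have zakA j y : Num.sqrt A <= normc (zak (m := m) b j y).
  have /andP[h _] := zakAB j y.
  by rewrite -(ger0_norm (normc_ge0 _)) -sqrtr_sqr ler_sqrt ?sqr_ge0.
have zakB j y : normc (zak (m := m) b j y) <= Num.sqrt B.
  have /andP[_ h] := zakAB j y.
  by rewrite -(ger0_norm (normc_ge0 _)) -sqrtr_sqr ler_sqrt // ltW.
have [g [K [g2 gq NK Kq]]] := grid_step rho01 q1 qN.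
have [g' [L [g2' gr NL Lr]]] := grid_step rho01 r1 rN.
have nE := sqr_dim m.
have small : 7 / 8 * Num.sqrt A + 2 * (Num.sqrt A / 20) < Num.sqrt A by lra.
have := vp_residuals_ge k nE sA0 zakA zakB rhoB g2 gq NK g2' gr NL.
set b1 := convolve _ _ _; set b2 := modulate _ _ _ => main.
have NE : 0 < m.+1%:R ^+ l :> R by rewrite exprn_gt0 ?ltr0n.
(* The residual of a convolution is a multiplier on the Fourier side, so Parseval leads to the
   frequency tail; for [b2] the multiplier acts on [b] itself. *)
have E1 : \sum_j normc (b j - b1 j) ^+ 2 <=
    m.+1%:R ^+ l * tail (dft b) k (m.+1%:R * q%:R / 2).
  have -> : \sum_j normc (b j - b1 j) ^+ 2 =
      \sum_j normc (([ffun i => b i - b1 i] : ell2 R m.+1 l) j) ^+ 2.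
    by apply: eq_bigr => j _; rewrite ffunE.
  rewrite -dft_parseval; under eq_bigr do rewrite dft_convolve_residual vp_kernel_transform.
  apply: (@residual_tail R m l (dft b) k q (fun j => vp_mult R _ (- j k))) => j.
    by rewrite vp_mult_ge0 vp_mult_le1.
  by move=> h; rewrite vp_mult_eq1 ?cyc_normN.
have E2 : \sum_j normc (b j - b2 j) ^+ 2 <=
    m.+1%:R ^+ l * tail b k (m.+1%:R * r%:R / 2).
  under eq_bigr do rewrite /b2 /modulate vp_kernel_transform -[X in X - _]mul1r -mulrBl.
  apply: (@residual_tail R m l b k r (fun j => vp_mult R _ (j k))) => j.
    by rewrite vp_mult_ge0 vp_mult_le1.
  by move=> h; rewrite vp_mult_eq1.
set X := tail b _ _ in E2 *; set Y := tail _ _ _ in E1 *.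
rewrite expr_div_n (sqr_sqrtr (ltW A0)) in main.
have KL0 : 0 < K.+1%:R * L.+1%:R :> R by rewrite mulr_gt0 ?ltr0n.
have q0 : 0 < q%:R :> R by rewrite ltr0n.
have r0 : 0 < r%:R :> R by rewrite ltr0n.
have key : A / 20 ^+ 2 <= K.+1%:R * L.+1%:R * (X + Y).
  rewrite -(ler_pM2r NE); apply: le_trans main _.
  rewrite -[leRHS]mulrA (ler_pM2l KL0) [(X + Y) * _]mulrC; lra.
have XY0 : 0 <= X + Y.
  by rewrite -(pmulr_rge0 _ KL0); apply: le_trans key; rewrite divr_ge0 ?sqr_ge0 // ltW.
have KL : K.+1%:R * L.+1%:R * (A / B) <= 64 ^+ 2 * (q%:R * r%:R).
  rewrite -rho2.
  have := ler_pM (mulr_ge0 (ler0n R K.+1) (ltW rho0)) (mulr_ge0 (ler0n R L.+1) (ltW rho0)) Kq Lr.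
  by rewrite expr2; lra.
rewrite ler_pdivrMr ?mulr_gt0 //.
have h1 : A / B * (A / 20 ^+ 2) <= A / B * (K.+1%:R * L.+1%:R * (X + Y)).
  by rewrite ler_pM2l ?divr_gt0.
have h2 := ler_wpM2r XY0 KL.
have -> : (A / (20 * 64)) ^+ 2 / B = A / B * (A / 20 ^+ 2) / 64 ^+ 2.
  by field; rewrite gt_eqF.
lra.
Qed.
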